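(* For any integer $n \geq 0$ (with $a$ denoting a nonnegative integer), $$v_2(B_n(4,0)) = \begin{cases} 0, & \text{if } n \equiv 0 \pmod{5}, \\ 1 + 2 v_2(a), & \text{if } n=5a + 1 \text{ and } v_2(a) \leq 2, \\ 1+ v_2\big(a(a+1)\big), & \text{if } n=5a + 2 \text{ and } v_2\big(a(a+1)\big) \leq 5, \\ 3, & \text{if } n=5a + 3 \text{ and } v_2(a+3) \geq 2, \\ 0, & \text{if } n \equiv 4 \pmod{5}. \end{cases}$$ (No assertion is made for values of $n$ not covered by these cases.)
   Context: The sequence $\{B_n(4,0)\}_{n\geq 0}$ is defined by $B_n = B_{n-1}+B_{n-2}+B_{n-3}+B_{n-4}$ for $n \geq 4$, with $(B_0,B_1,B_2,B_3)=(1,0,0,0)$. $v_2$ denotes the 2-adic order (2-adic valuation), with the convention $v_2(0)=+\infty$. *)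

(* Defs.v *)
From mathcomp Require Import all_boot all_order all_algebra.
From mathcomp Require Import constructive_ereal.

Set Implicit Arguments.
Unset Strict Implicit.
Unset Printing Implicit Defensive.

(* B n is B_n(4,0); the recurrence and the initial values stay in the natural
   numbers. *)
Fixpoint B (n : nat) : nat :=
  match n with
  | 0 => 1
  | 1 | 2 | 3 => 0
  | (((n4.+1 as n3).+1 as n2).+1 as n1).+1 => B n1 + B n2 + B n3 + B n4
  end.

(* Valued in the extended integers because v_2(0) = +oo, whereas the library
   sets logn 2 0 = 0. *)
Definition v2 (n : nat) : \bar int :=
  if n == 0 then +oo%E else ((logn 2 n)%:Z)%:E.

(* Main.v *)
Require Import Defs.
From mathcomp Require Import all_boot all_order all_algebra.
From mathcomp Require Import constructive_ereal.

(** Every valuation asserted by the theorem is at most 6, hence can be read off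
    modulo [2 ^ 7]. Modulo 128 the sequence has period [320 = 5 * 64], while
    [v2 a <= 2], [v2 (a * (a + 1)) <= 5] and [2 <= v2 (a + 3)] depend only on
    [a] modulo 64, so the theorem reduces to computing one period. *)

Set Implicit Arguments.
Unset Strict Implicit.
Unset Printing Implicit Defensive.

(* The minimum of [k] and the 2-adic valuation of [m], including at [m = 0]. *)
Definition capv2 (k m : nat) : nat := logn 2 (gcdn m (2 ^ k)).

Lemma capv2_0 (k : nat) : capv2 k 0 = k.
Proof. by rewrite /capv2 gcd0n pfactorK. Qed.

Lemma capv2_minn (k m : nat) : 0 < m -> capv2 k m = minn (logn 2 m) k.
Proof. by move=> m_gt0; rewrite /capv2 logn_gcd ?expn_gt0 // pfactorK. Qed.

Lemma eq_mod_capv2 (k m n : nat) : m = n %[mod 2 ^ k] -> capv2 k m = capv2 k n.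
Proof. by move=> eq_mn; rewrite /capv2 -gcdn_modl eq_mn gcdn_modl. Qed.

(** A value strictly below the cap is not truncated; this also excludes [m = 0], whose capped
    valuation is [k] itself. *)
Lemma v2_capv2 (k m : nat) : capv2 k m < k -> v2 m = ((capv2 k m)%:Z)%:E.
Proof.
rewrite /v2; case: posnP => [->|m_gt0]; first by rewrite capv2_0 ltnn.
by rewrite capv2_minn // gtn_min ltnn orbF => /ltnW/minn_idPl->.
Qed.

Lemma v2_le_capv2 (k j m : nat) :
  j < k -> (v2 m <= (j%:Z)%:E)%E = (capv2 k m <= j).
Proof.
move=> lt_jk; rewrite /v2; case: posnP => [->|m_gt0].
  by rewrite capv2_0 [RHS]leqNgt lt_jk.
by rewrite lee_fin lez_nat capv2_minn // geq_min [k <= j]leqNgt lt_jk orbF.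
Qed.

Lemma v2_ge_capv2 (k j m : nat) :
  j <= k -> ((j%:Z)%:E <= v2 m)%E = (j <= capv2 k m).
Proof.
move=> le_jk; rewrite /v2; case: posnP => [->|m_gt0].
  by rewrite capv2_0 le_jk leey.
by rewrite lee_fin lez_nat capv2_minn // leq_min le_jk andbT.
Qed.

Lemma B_rec (n : nat) : B n.+4 = B n.+3 + B n.+2 + B n.+1 + B n.
Proof. by []. Qed.

(** Four consecutive residues determine all later ones and are cheap to iterate, whereas evaluating
    [B] itself branches exponentially. *)
Definition window_step (d : nat) (s : nat * nat * nat * nat) :=
  let: (x, y, z, t) := s in (y, z, t, (t + z + y + x) %% d).

(** The initial 1 is reduced too, so that [windowE] also holds for [d = 1]. *)
Definition window (d n : nat) := iter n (window_step d) (1 %% d, 0, 0, 0).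

Lemma windowE (d n : nat) :
  window d n = (B n %% d, B n.+1 %% d, B n.+2 %% d, B n.+3 %% d).
Proof.
elim: n => [|n IHn]; first by rewrite /window /= !mod0n.
rewrite /window iterS -/(window d n) IHn /window_step B_rec.
congr (_, _).
rewrite modnDmr -!addnA modnDml addnCA modnDml addnA addnCA modnDml.
by rewrite addnCA addnA [B n.+2 + _]addnC !addnA.
Qed.

Definition Bmod (d n : nat) : nat := (window d n).1.1.1.

Lemma BmodE (d n : nat) : Bmod d n = B n %% d.
Proof. by rewrite /Bmod windowE. Qed.

(** Windows are iterates of one fixed map, so a single return to the initial window forces
    periodicity. *)
Lemma Bmod_period (d p q n : nat) :
  window d p = window d 0 -> Bmod d (n + q * p) = Bmod d n.
Proof.
move=> period; congr (_.1.1.1).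
by rewrite /window iterD iterM (iter_fix _ period).
Qed.

Lemma window128_period : window 128 320 = window 128 0.
Proof. by vm_compute. Qed.

(** A decidable form of the theorem. The cap 6 suffices to test the bounds 2 and 5 on [a].
    Abstracting over [b] lets it apply both to the computed residues and to [B]. *)
Definition capped_theorem (b : nat -> nat) (a : nat) : bool :=
  [&& b 0 == 0,
      (capv2 6 a <= 2) ==> (b 1 == 1 + 2 * capv2 6 a),
      (capv2 6 (a * (a + 1)) <= 5) ==> (b 2 == 1 + capv2 6 (a * (a + 1))),
      (2 <= capv2 6 (a + 3)) ==> (b 3 == 3)
    & b 4 == 0].

Lemma capped_theorem_period :
  all (fun c => capped_theorem (fun i => capv2 7 (Bmod 128 (5 * c + i))) c)
      (iota 0 64).
Proof. by vm_compute. Qed.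

Lemma capped_theoremP (a : nat) :
  capped_theorem (fun i => capv2 7 (B (5 * a + i))) a.
Proof.
have c_lt : a %% 64 \in iota 0 64 by rewrite mem_iota ltn_pmod.
have BE i : capv2 7 (B (5 * a + i)) = capv2 7 (Bmod 128 (5 * (a %% 64) + i)).
  rewrite -(Bmod_period (a %/ 64) _ window128_period) BmodE.
  (* Shifting the index by [a %/ 64] periods turns [5 * (a %% 64) + i] into [5 * a + i]. *)
  rewrite -[320]/(5 * 64) mulnCA addnAC -mulnDr [_ %% _ + _]addnC -divn_eq.
  by apply: eq_mod_capv2; rewrite modn_mod.
have := allP capped_theorem_period _ c_lt; rewrite /capped_theorem !BE.
have -> : capv2 6 (a %% 64) = capv2 6 a by apply: eq_mod_capv2; rewrite modn_mod.
have -> : capv2 6 (a %% 64 + 3) = capv2 6 (a + 3).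
  by apply: eq_mod_capv2; rewrite modnDml.
have -> // : capv2 6 (a %% 64 * (a %% 64 + 1)) = capv2 6 (a * (a + 1)).
by apply: eq_mod_capv2; rewrite modnMml -modnMmr modnDml modnMmr.
Qed.

Lemma v2_B (n k : nat) : k < 7 -> capv2 7 (B n) = k -> v2 (B n) = (k%:Z)%:E.
Proof. by move=> k_lt def_k; rewrite (@v2_capv2 7) def_k. Qed.

Theorem theorem13 (n : nat) :
  [/\ (n = 0 %[mod 5])%N -> v2 (B n) = 0%E,
      (forall a : nat, n = (5 * a + 1)%N -> (v2 a <= 2%:E)%E ->
         v2 (B n) = (1 + 2%:E * v2 a)%E),
      (forall a : nat, n = (5 * a + 2)%N -> (v2 (a * (a + 1)) <= 5%:E)%E ->
         v2 (B n) = (1 + v2 (a * (a + 1)))%E),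
      (forall a : nat, n = (5 * a + 3)%N -> (2%:E <= v2 (a + 3))%E ->
         v2 (B n) = 3%:E)
    & (n = 4 %[mod 5])%N -> v2 (B n) = 0%E].
Proof.
split=> [n_mod|a ->|a ->|a ->|n_mod].
- have /and5P[/eqP B0 _ _ _ _] := capped_theoremP (n %/ 5).
  by rewrite (divn_eq n 5) n_mod mulnC; apply: v2_B.
- rewrite (@v2_le_capv2 6 2) // => a_le.
  have /and5P[_ /implyP/(_ a_le)/eqP B1 _ _ _] := capped_theoremP a.
  (* The side condition holds since [1 + 2 * c] is at most 5 for [c <= 2], below the cap 7. *)
  rewrite (v2_B _ B1); last by case: capv2 a_le => [|[|[]]].
  by rewrite (@v2_capv2 6) 1?(leq_ltn_trans a_le) // PoszD PoszM EFinD EFinM.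
- rewrite (@v2_le_capv2 6 5) // => a_le.
  have /and5P[_ _ /implyP/(_ a_le)/eqP B2 _ _] := capped_theoremP a.
  by rewrite (v2_B _ B2) ?(@v2_capv2 6 (a * (a + 1))) // PoszD EFinD.
- rewrite (@v2_ge_capv2 6 2) // => a_ge.
  have /and5P[_ _ _ /implyP/(_ a_ge)/eqP B3 _] := capped_theoremP a.
  exact: v2_B B3.
- have /and5P[_ _ _ _ /eqP B4] := capped_theoremP (n %/ 5).
  by rewrite (divn_eq n 5) n_mod mulnC; apply: v2_B.
Qed.
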